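(* Let $(\mathcal D_\ell,\mathsf J_\ell)$, $\ell=1,2$, be Darboux integrable elliptic distributions on connected manifolds $M_1,M_2$, with Vessiot algebras $\mathfrak g_1,\mathfrak g_2$, that are equivalent via a diffeomorphism $\Phi:M_1\to M_2$. Then $\mathfrak g_1$ and $\mathfrak g_2$ are isomorphic as real Lie algebras.
   Context: Conventions. Everything is real-analytic; repeated indices are summed; $\perp$ is the annihilator. $I^{(\infty)}$ is the terminal derived system of a bundle $I$ of (complex) 1-forms ($I'$ is spanned by sections $\theta$ of $I$ with $d\theta\in I\wedge T^*M$, iterated); $\mathcal D^{(\infty)}$ is the terminal derived distribution (iterated brackets). Constant ranks are assumed. Elliptic distribution on $M$: $(\mathcal D,\mathsf J)$ with $\mathcal D\subset TM$ of even rank $2d<m=\dim M$, $\mathcal D^{(\infty)}=TM$, $\mathsf J:\mathcal D\to\mathcal D$ with $\mathsf J^2=-\mathrm{Id}$, $[\mathcal D_+,\mathcal D_-]\subset\mathcal D\otimes\mathbb C$ with $\mathcal D_\pm$ the $\pm\mathrm i$-eigenspaces of $\mathsf J$ on $\mathcal D\otimes\mathbb C$. Singular bundle: $V=(\mathcal D_-)^\perp\subset T^*M\otimes\mathbb C$; $q=\operatorname{rank}V^{(\infty)}$, $n=m-2q$, $I=\mathcal D^\perp$. $\mathscr H(V)$ is the set of (possibly local) functions $f:M\to\mathbb C$ with $df\in V^{(\infty)}$. Darboux integrable: $V^{(\infty)}+\overline V=T^*M\otimes\mathbb C$. Equivalence: $(\mathcal D_1,\mathsf J_1)$ and $(\mathcal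 D_2,\mathsf J_2)$ are equivalent via a diffeomorphism $\Phi:M_1\to M_2$ if $\Phi_*\mathcal D_1=\mathcal D_2$ and either $\Phi_*\mathsf J_1(X)=\mathsf J_2(\Phi_*X)$ for all $X\in\mathcal D_1$, or $\Phi_*\mathsf J_1(X)=-\mathsf J_2(\Phi_*X)$ for all $X\in\mathcal D_1$. Vessiot coframe based at $x_0$, on an open set $U\ni x_0$: a complex coframe $(\theta^i,\eta^r,\sigma^u,\overline{\eta^r},\overline{\sigma^u})$, $1\le i\le n$, $1\le r\le q-d$, $1\le u\le d$, with $V^{(\infty)}=\operatorname{span}_{\mathbb C}\{\eta^r,\sigma^u\}$, $I\otimes\mathbb C=\operatorname{span}_{\mathbb C}\{\theta^i,\eta^r,\overline{\eta^r}\}$, and, writing $(\pi^a)=(\eta^r,\sigma^u)$ and $\theta^i\equiv P^i_j\overline{\theta^j}\bmod\eta^r,\overline{\eta^r}$: $d\sigma^u=0$, $d\eta^r=\tfrac12E^r_{uv}\sigma^u\wedge\sigma^v+F^r_{us}\sigma^u\wedge\eta^s$, $d\theta^i=\tfrac12A^i_{ab}\pi^a\wedge\pi^b+\tfrac12P^i_j\overline{A^j_{ab}}\,\overline{\pi^a}\wedge\overline{\pi^b}+\tfrac12C^i_{jk}\theta^j\wedge\theta^k+M^i_{aj}\pi^a\wedge\theta^j$, with $A,M,E,F$ having entries in $\mathscr H(V)$, the $\theta^i$ imaginary-valued on real vectors in $T_{x_0}M$, and $C^i_{jk}$ real constants that are structure constants of an $n$-dimensional real Lie algebra. A Vessiot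 coframe based at any given point exists. On a connected manifold the isomorphism class of this real Lie algebra is independent of the base point and of the coframe; it is called the Vessiot algebra of $(\mathcal D,\mathsf J)$. *)

(* Defs.v *)
From HB Require Import structures.
From mathcomp Require Import all_boot all_order all_algebra.
From mathcomp Require Import all_classical all_reals all_analysis.
From mathcomp Require Import complex.

Set Implicit Arguments.
Unset Strict Implicit.
Unset Printing Implicit Defensive.

Import Order.TTheory GRing.Theory Num.Theory.
Import numFieldNormedType.Exports.

Local Open Scope classical_set_scope.
Local Open Scope complex_scope.
Local Open Scope ring_scope.

Definition monomial (R : realType) (m N : nat)
    (alpha : {ffun 'I_m -> 'I_N}) (h : 'rV[R]_m) : R :=
  \prod_(i < m) h ord0 i ^+ alpha i.

(* [f] is, on a polydisc centred at [a], the sum of an absolutely convergent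
   power series; the partial sums run over the boxes [0, N)^m of exponents. *)
Definition real_analytic (R : realType) (m : nat)
    (f : 'rV[R]_m -> R) (a : 'rV[R]_m) : Prop :=
  exists (c : ('I_m -> nat) -> R) (r : R), 0 < r /\
    forall h : 'rV[R]_m, (forall i, `|h ord0 i| < r) ->
      (exists B : R, forall N : nat,
         \sum_(alpha : {ffun 'I_m -> 'I_N})
            `|c (fun i => alpha i) * monomial alpha h| <= B) /\
      ((fun N : nat => \sum_(alpha : {ffun 'I_m -> 'I_N})
            c (fun i => alpha i) * monomial alpha h) @ \oo --> f (a + h)).

(* A manifold is a Hausdorff second countable space carrying a sheaf of
   analytic functions locally isomorphic to that of an open subset of R^m.
   [analytic_at f x] says that [f] is analytic on a neighbourhood of [x]; the
   values of [f] away from [x] are irrelevant, so that total functions stand for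
   germs, and analyticity of the transition maps follows from [mf_charts]. *)
Record analyticManifold (R : realType) := AnalyticManifold {
  mf_carrier :> topologicalType;
  mf_dim : nat;
  mf_hausdorff : hausdorff_space mf_carrier;
  mf_second_countable : @second_countable mf_carrier;
  analytic_at : (mf_carrier -> R) -> mf_carrier -> Prop;
  mf_charts : forall x : mf_carrier,
    exists (U : set mf_carrier) (phi : mf_carrier -> 'rV[R]_mf_dim)
           (psi : 'rV[R]_mf_dim -> mf_carrier),
      [/\ open U, U x & open (phi @` U)] /\
      forall y, U y ->
        [/\ psi (phi y) = y, {for y, continuous phi},
            {for phi y, continuous psi}
          & forall f : mf_carrier -> R,
              analytic_at f y <-> real_analytic (f \o psi) (phi y)]
}.

Arguments mf_dim {R} M : rename.
Arguments analytic_at {R} {M} f x : rename.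

Definition connected_manifold (R : realType) (M : analyticManifold R) : Prop :=
  [set: M] !=set0 /\ connected [set: M].

Definition analytic_map (R : realType) (M N : analyticManifold R)
    (F : M -> N) : Prop :=
  continuous F /\
  forall (x : M) (f : N -> R), analytic_at f (F x) -> analytic_at (f \o F) x.

Definition diffeomorphism (R : realType) (M N : analyticManifold R)
    (F : M -> N) : Prop :=
  exists G : N -> M,
    [/\ cancel F G, cancel G F, analytic_map F & analytic_map G].

Definition lincomb (R : realType) (T : Type) (K : finType)
    (c : K -> R[i]) (e : K -> T -> R[i]) : T -> R[i] :=
  fun t => \sum_k c k * e k t.

Definition cspan (R : realType) (T : Type) (K : finType)
    (e : K -> T -> R[i]) : set (T -> R[i]) :=
  [set v | exists c : K -> R[i], v = lincomb c e].

Definition cspan_set (R : realType) (T : Type) (S : set (T -> R[i])) :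
    set (T -> R[i]) :=
  [set v | exists (N : nat) (e : 'I_N -> T -> R[i]),
     (forall k, S (e k)) /\ cspan e v].

Definition cbasis (R : realType) (T : Type) (K : finType)
    (S : set (T -> R[i])) (e : K -> T -> R[i]) : Prop :=
  S = cspan e /\
  forall c : K -> R[i], lincomb c e = (fun=> 0) -> forall k, c k = 0.

Definition crank (R : realType) (T : Type) (S : set (T -> R[i])) (r : nat) :
    Prop :=
  exists e : 'I_r -> T -> R[i], cbasis S e.

Definition rspan (R : realType) (T : Type) (K : finType)
    (e : K -> T -> R[i]) : set (T -> R[i]) :=
  [set v | exists a : K -> R, v = lincomb (fun k => (a k)%:C) e].

Definition rspan_set (R : realType) (T : Type) (S : set (T -> R[i])) :
    set (T -> R[i]) :=
  [set v | exists (N : nat) (e : 'I_N -> T -> R[i]),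
     (forall k, S (e k)) /\ rspan e v].

Definition rbasis (R : realType) (T : Type) (K : finType)
    (S : set (T -> R[i])) (e : K -> T -> R[i]) : Prop :=
  S = rspan e /\
  forall a : K -> R,
    lincomb (fun k => (a k)%:C) e = (fun=> 0) -> forall k, a k = 0.

Definition rrank (R : realType) (T : Type) (S : set (T -> R[i])) (r : nat) :
    Prop :=
  exists e : 'I_r -> T -> R[i], rbasis S e.

Definition add_i (R : realType) (T : Type) (v w : T -> R[i]) : T -> R[i] :=
  fun t => v t + 'i%C * w t.

Definition complexify (R : realType) (T : Type) (S : set (T -> R[i])) :
    set (T -> R[i]) :=
  [set z | exists v w, [/\ S v, S w & z = add_i v w]].

(* A complex tangent vector at a point is a C-linear derivation of germs of
   complex-valued analytic functions, which gives TM (x) C; real vectors are the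
   ones fixed by conjugation. Complex covectors are C-linear functionals on
   complex tangent vectors. Vectors vanish on functions that are not analytic
   at the point, and covectors vanish on non-vectors, so that equality of
   functions is the intended equality. *)

Definition tvec (R : realType) (M : analyticManifold R) := (M -> R[i]) -> R[i].
Definition covec (R : realType) (M : analyticManifold R) := tvec M -> R[i].

Definition canalytic_at (R : realType) (M : analyticManifold R)
    (f : M -> R[i]) (x : M) : Prop :=
  analytic_at (fun y => complex.Re (f y)) x /\
  analytic_at (fun y => complex.Im (f y)) x.

Definition ctangent (R : realType) (M : analyticManifold R) (x : M) :
    set (tvec M) :=
  [set v | [/\
    forall (a : R[i]) (f g : M -> R[i]), canalytic_at f x -> canalytic_at g x ->
      v (fun y => a * f y + g y) = a * v f + v g,
    forall f g : M -> R[i], canalytic_at f x -> canalytic_at g x ->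
      v (fun y => f y * g y) = f x * v g + v f * g x
    & forall f : M -> R[i], ~ canalytic_at f x -> v f = 0]].

Definition conj_tvec (R : realType) (M : analyticManifold R) (v : tvec M) :
    tvec M :=
  fun f => conjc (v (fun y => conjc (f y))).

Definition tangent (R : realType) (M : analyticManifold R) (x : M) :
    set (tvec M) :=
  [set v | ctangent x v /\ conj_tvec v = v].

Definition ccotangent (R : realType) (M : analyticManifold R) (x : M) :
    set (covec M) :=
  [set w | (forall (a : R[i]) (u v : tvec M), ctangent x u -> ctangent x v ->
              w (fun f => a * u f + v f) = a * w u + w v) /\
           (forall v : tvec M, ~ ctangent x v -> w v = 0)].

Definition conj_covec (R : realType) (M : analyticManifold R) (w : covec M) :
    covec M :=
  fun v => conjc (w (conj_tvec v)).

Definition cotangent (R : realType) (M : analyticManifold R) (x : M) :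
    set (covec M) :=
  [set w | ccotangent x w /\ conj_covec w = w].

Definition cfield (R : realType) (M : analyticManifold R) (U : set M)
    (X : M -> tvec M) : Prop :=
  forall x, U x -> ctangent x (X x) /\
    forall f : M -> R[i], canalytic_at f x -> canalytic_at (fun y => X y f) x.

Definition section (R : realType) (M : analyticManifold R)
    (D : M -> set (tvec M)) (U : set M) (X : M -> tvec M) : Prop :=
  cfield U X /\ forall x, U x -> D x (X x).

Definition bracket (R : realType) (M : analyticManifold R)
    (X Y : M -> tvec M) : M -> tvec M :=
  fun x f => if `[< canalytic_at f x >]
             then X x (fun y => Y y f) - Y x (fun y => X y f) else 0.

Definition cform (R : realType) (M : analyticManifold R) (U : set M)
    (w : M -> covec M) : Prop :=
  forall x, U x -> ccotangent x (w x) /\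
    forall (W : set M) (X : M -> tvec M), open W -> W x -> cfield W X ->
      canalytic_at (fun y => w y (X y)) x.

Definition differential (R : realType) (M : analyticManifold R)
    (f : M -> R[i]) (x : M) : covec M :=
  fun v => if `[< ctangent x v >] then v f else 0.

Definition wedge (R : realType) (M : analyticManifold R) (a b : covec M)
    (u v : tvec M) : R[i] :=
  a u * b v - a v * b u.

(* The value at [x] of d[w], computed by Cartan's formula
   X(w(Y)) - Y(w(X)) - w([X, Y]), is the 2-form [Omega]. *)
Definition ext_deriv_at (R : realType) (M : analyticManifold R)
    (w : M -> covec M) (x : M) (Omega : tvec M -> tvec M -> R[i]) : Prop :=
  forall (W : set M) (X Y : M -> tvec M),
    open W -> W x -> cfield W X -> cfield W Y ->
    X x (fun y => w y (Y y)) - Y x (fun y => w y (X y)) - w x (bracket X Y x) =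
    Omega (X x) (Y x).

(* [d w] lies at [x] in the ideal generated by [V x]. *)
Definition deriv_in_ideal (R : realType) (M : analyticManifold R)
    (V : M -> set (covec M)) (w : M -> covec M) (x : M) : Prop :=
  exists (N : nat) (a b : 'I_N -> covec M),
    [/\ forall k, V x (a k), forall k, ccotangent x (b k)
      & ext_deriv_at w x (fun u v => \sum_k wedge (a k) (b k) u v)].

Definition derived_system (R : realType) (M : analyticManifold R)
    (V : M -> set (covec M)) : M -> set (covec M) :=
  fun x => cspan_set [set z | exists (U : set M) (w : M -> covec M),
    [/\ open U, U x, cform U w,
        forall y, U y -> V y (w y) /\ deriv_in_ideal V w y & z = w x]].

(* The derived systems decrease, so the terminal one is their intersection. *)
Definition terminal_system (R : realType) (M : analyticManifold R)
    (V : M -> set (covec M)) : M -> set (covec M) :=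
  fun x => [set w | forall k : nat, iter k (@derived_system R M) V x w].

Definition derived_distribution (R : realType) (M : analyticManifold R)
    (D : M -> set (tvec M)) : M -> set (tvec M) :=
  fun x => rspan_set (D x `|` [set z | exists (U : set M) (X Y : M -> tvec M),
    [/\ open U, U x, section D U X, section D U Y & z = bracket X Y x]]).

(* The derived distributions increase, so the terminal one is their union. *)
Definition terminal_distribution (R : realType) (M : analyticManifold R)
    (D : M -> set (tvec M)) : M -> set (tvec M) :=
  fun x => [set v | exists k : nat, iter k (@derived_distribution R M) D x v].

Definition analytic_distribution (R : realType) (M : analyticManifold R)
    (D : M -> set (tvec M)) (r : nat) : Prop :=
  (forall x, D x `<=` tangent x) /\
  forall x, exists (U : set M) (X : 'I_r -> M -> tvec M),
    [/\ open U, U x, forall k, cfield U (X k)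
      & forall y, U y -> rbasis (D y) (fun k => X k y)].

(* The eigenspace of the C-linear extension of [J] to the complexification. *)
Definition eigendist (R : realType) (M : analyticManifold R)
    (D : M -> set (tvec M)) (J : M -> tvec M -> tvec M) (lambda : R[i]) :
    M -> set (tvec M) :=
  fun x => [set z | exists v w, [/\ D x v, D x w, z = add_i v w
    & add_i (J x v) (J x w) = (fun f => lambda * z f)]].

Definition annihilator (R : realType) (M : analyticManifold R)
    (S : M -> set (tvec M)) : M -> set (covec M) :=
  fun x => [set w | ccotangent x w /\ forall v, S x v -> w v = 0].

Definition singular_bundle (R : realType) (M : analyticManifold R)
    (D : M -> set (tvec M)) (J : M -> tvec M -> tvec M) : M -> set (covec M) :=
  annihilator (eigendist D J (- 'i%C)).

(* [ell_J x v] is meaningful only for [v] in [ell_D x]. *)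
Record ellipticDistribution (R : realType) (M : analyticManifold R) :=
  EllipticDistribution {
  ell_d : nat;
  ell_D : M -> set (tvec M);
  ell_J : M -> tvec M -> tvec M;
  ell_rank_lt : (2 * ell_d < mf_dim M)%N;
  ell_subbundle : analytic_distribution ell_D (2 * ell_d);
  ell_terminal : forall x, terminal_distribution ell_D x = tangent x;
  ell_J_stable : forall x v, ell_D x v -> ell_D x (ell_J x v);
  ell_J_linear : forall x (a : R) v w, ell_D x v -> ell_D x w ->
    ell_J x (fun f => a%:C * v f + w f) =
    (fun f => a%:C * ell_J x v f + ell_J x w f);
  ell_J_analytic : forall U X, open U -> section ell_D U X ->
    cfield U (fun x => ell_J x (X x));
  ell_J_square : forall x v, ell_D x v ->
    ell_J x (ell_J x v) = (fun f => - v f);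
  ell_bracket : forall U X Y x, open U -> U x ->
    section (eigendist ell_D ell_J 'i%C) U X ->
    section (eigendist ell_D ell_J (- 'i%C)) U Y ->
    complexify (ell_D x) (bracket X Y x);
  ell_constant_rank_D : forall k : nat, exists r : nat, forall x,
    rrank (iter k (@derived_distribution R M) ell_D x) r;
  ell_constant_rank_V : forall k : nat, exists r : nat, forall x,
    crank (iter k (@derived_system R M) (singular_bundle ell_D ell_J) x) r
}.

Definition ell_V (R : realType) (M : analyticManifold R)
    (E : ellipticDistribution M) : M -> set (covec M) :=
  singular_bundle (ell_D E) (ell_J E).

Definition ell_Vinf (R : realType) (M : analyticManifold R)
    (E : ellipticDistribution M) : M -> set (covec M) :=
  terminal_system (ell_V E).

Definition ell_I (R : realType) (M : analyticManifold R)
    (E : ellipticDistribution M) : M -> set (covec M) :=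
  fun x => cotangent x `&` annihilator (ell_D E) x.

Definition darboux_integrable (R : realType) (M : analyticManifold R)
    (E : ellipticDistribution M) : Prop :=
  forall x : M, ccotangent x =
    [set w | exists a b : covec M, [/\ ell_Vinf E x a, ell_V E x b
       & w = (fun v => a v + conj_covec b v)]].

(* Membership of [f] in H(V), for [f] defined on [U]. *)
Definition darboux_invariant (R : realType) (M : analyticManifold R)
    (E : ellipticDistribution M) (U : set M) (f : M -> R[i]) : Prop :=
  forall x, U x -> canalytic_at f x /\ ell_Vinf E x (differential f x).

Definition pushforward (R : realType) (M N : analyticManifold R)
    (F : M -> N) (v : tvec M) : tvec N :=
  fun g => v (g \o F).

Definition equivalent_via (R : realType) (M1 M2 : analyticManifold R)
    (E1 : ellipticDistribution M1) (E2 : ellipticDistribution M2)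
    (F : M1 -> M2) : Prop :=
  [/\ diffeomorphism F,
      forall x : M1, pushforward F @` ell_D E1 x = ell_D E2 (F x)
    & (forall (x : M1) (v : tvec M1), ell_D E1 x v ->
         pushforward F (ell_J E1 x v) = ell_J E2 (F x) (pushforward F v)) \/
      (forall (x : M1) (v : tvec M1), ell_D E1 x v ->
         pushforward F (ell_J E1 x v) =
         (fun g => - ell_J E2 (F x) (pushforward F v) g))].

Record lieAlgebra (R : realType) := LieAlgebra {
  lie_carrier :> vectType R;
  lie : lie_carrier -> lie_carrier -> lie_carrier;
  lie_linearl : forall (a : R) x y z, lie (a *: x + y) z = a *: lie x z + lie y z;
  lie_linearr : forall (a : R) x y z, lie x (a *: y + z) = a *: lie x y + lie x z;
  lie_alternating : forall x, lie x x = 0;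
  lie_jacobi : forall x y z,
    lie x (lie y z) + lie y (lie z x) + lie z (lie x y) = 0
}.

Definition lie_isomorphic (R : realType) (g h : lieAlgebra R) : Prop :=
  exists f : {linear g -> h},
    bijective f /\ forall x y : g, f (lie x y) = lie (f x) (f y).

(* In some basis [e] of [g], [e_j, e_k] = C^i_jk e_i. *)
Definition structure_constants (R : realType) (g : lieAlgebra R) (n : nat)
    (C : 'I_n -> 'I_n -> 'I_n -> R) : Prop :=
  exists e : n.-tuple g, basis_of fullv e /\
    forall j k, lie (tnth e j) (tnth e k) = \sum_i C i j k *: tnth e i.

(* Here [s] is q - d, so that q = s + d. The index type of the 1-forms pi^a,
   namely the eta^r followed by the sigma^u, is ['I_s + 'I_d]. *)
Definition pi_forms (R : realType) (M : analyticManifold R) (s d : nat)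
    (eta : 'I_s -> M -> covec M) (sigma : 'I_d -> M -> covec M) (x : M)
    (a : 'I_s + 'I_d) : covec M :=
  match a with inl r => eta r x | inr u => sigma u x end.

Definition with_conj (R : realType) (M : analyticManifold R) (K : finType)
    (e : K -> covec M) (a : K + K) : covec M :=
  match a with inl k => e k | inr k => conj_covec (e k) end.

Definition join_forms (R : realType) (M : analyticManifold R) (K L : finType)
    (e : K -> covec M) (e' : L -> covec M) (a : K + L) : covec M :=
  match a with inl k => e k | inr l => e' l end.

Record vessiotCoframe (R : realType) (M : analyticManifold R)
    (E : ellipticDistribution M) (x0 : M) (n : nat)
    (C : 'I_n -> 'I_n -> 'I_n -> R) := VessiotCoframe {
  vc_s : nat;
  vc_dom : set M;
  vc_theta : 'I_n -> M -> covec M;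
  vc_eta : 'I_vc_s -> M -> covec M;
  vc_sigma : 'I_(ell_d E) -> M -> covec M;
  vc_pi := pi_forms vc_eta vc_sigma;
  vc_A : 'I_n -> 'I_vc_s + 'I_(ell_d E) -> 'I_vc_s + 'I_(ell_d E) -> M -> R[i];
  vc_M : 'I_n -> 'I_vc_s + 'I_(ell_d E) -> 'I_n -> M -> R[i];
  vc_E : 'I_vc_s -> 'I_(ell_d E) -> 'I_(ell_d E) -> M -> R[i];
  vc_F : 'I_vc_s -> 'I_(ell_d E) -> 'I_vc_s -> M -> R[i];
  vc_P : 'I_n -> 'I_n -> M -> R[i];

  vc_rank_Vinf : forall x, crank (ell_Vinf E x) (vc_s + ell_d E);
  vc_dim : mf_dim M = (n + 2 * (vc_s + ell_d E))%N;
  vc_open : open vc_dom;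
  vc_base : vc_dom x0;
  vc_form_theta : forall i, cform vc_dom (vc_theta i);
  vc_form_eta : forall r, cform vc_dom (vc_eta r);
  vc_form_sigma : forall u, cform vc_dom (vc_sigma u);
  vc_coframe : forall x, vc_dom x ->
    cbasis (ccotangent x)
      (join_forms (fun i => vc_theta i x) (with_conj (vc_pi x)));
  vc_span_Vinf : forall x, vc_dom x -> ell_Vinf E x = cspan (vc_pi x);
  vc_span_I : forall x, vc_dom x ->
    complexify (ell_I E x) =
    cspan (join_forms (fun i => vc_theta i x)
                      (with_conj (fun r => vc_eta r x)));
  vc_P_def : forall x i, vc_dom x ->
    cspan (with_conj (fun r => vc_eta r x))
      (fun v => vc_theta i x v -
                \sum_j vc_P i j x * conj_covec (vc_theta j x) v);

  vc_dsigma : forall x u, vc_dom x ->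
    ext_deriv_at (vc_sigma u) x (fun _ _ => 0);
  vc_deta : forall x r, vc_dom x ->
    ext_deriv_at (vc_eta r) x (fun X Y =>
      2^-1 * (\sum_u \sum_v
                vc_E r u v x * wedge (vc_sigma u x) (vc_sigma v x) X Y) +
      \sum_u \sum_t vc_F r u t x * wedge (vc_sigma u x) (vc_eta t x) X Y);
  vc_dtheta : forall x i, vc_dom x ->
    ext_deriv_at (vc_theta i) x (fun X Y =>
      2^-1 * (\sum_a \sum_b
                vc_A i a b x * wedge (vc_pi x a) (vc_pi x b) X Y) +
      2^-1 * (\sum_j \sum_a \sum_b
                vc_P i j x * conjc (vc_A j a b x) *
                wedge (conj_covec (vc_pi x a)) (conj_covec (vc_pi x b)) X Y) +
      2^-1 * (\sum_j \sum_k
                (C i j k)%:C * wedge (vc_theta j x) (vc_theta k x) X Y) +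
      \sum_a \sum_j vc_M i a j x * wedge (vc_pi x a) (vc_theta j x) X Y);

  vc_A_inv : forall i a b, darboux_invariant E vc_dom (vc_A i a b);
  vc_M_inv : forall i a j, darboux_invariant E vc_dom (vc_M i a j);
  vc_E_inv : forall r u v, darboux_invariant E vc_dom (vc_E r u v);
  vc_F_inv : forall r u t, darboux_invariant E vc_dom (vc_F r u t);
  vc_theta_imaginary : forall i v, tangent x0 v ->
    complex.Re (vc_theta i x0 v) = 0;
  vc_C_lie : exists g : lieAlgebra R, structure_constants g C
}.

(* [g] belongs to the isomorphism class common to the Lie algebras of all the
   Vessiot coframes of [E], at all base points. *)
Definition is_vessiot_algebra (R : realType) (M : analyticManifold R)
    (E : ellipticDistribution M) (g : lieAlgebra R) : Prop :=
  forall x0 : M,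
    (exists (n : nat) (C : 'I_n -> 'I_n -> 'I_n -> R),
       inhabited (vessiotCoframe E x0 C)) /\
    (forall (n : nat) (C : 'I_n -> 'I_n -> 'I_n -> R),
       vessiotCoframe E x0 C -> structure_constants g C).

(* Main.v *)
Require Import Defs.
From HB Require Import structures.
From mathcomp Require Import all_boot all_order all_algebra.
From mathcomp Require Import all_classical all_reals all_analysis.
From mathcomp Require Import complex.

Set Implicit Arguments.
Unset Strict Implicit.
Unset Printing Implicit Defensive.

Import Order.TTheory GRing.Theory Num.Theory.
Import numFieldNormedType.Exports.

Local Open Scope classical_set_scope.
Local Open Scope complex_scope.
Local Open Scope ring_scope.

(** A Vessiot coframe is built from data that a diffeomorphism carries along:
    exterior derivatives, derived systems, annihilators and first integrals are
    all natural. If [Phi] intertwines J1 and J2, pushing forward a Vessiot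
    coframe of E1 at x0 gives a Vessiot coframe of E2 at Phi(x0) with the same
    constants C^i_jk. If [Phi] reverses J, it carries V1 to the complex
    conjugate of V2, and one pushes forward the conjugate coframe
    (conj theta, conj eta, conj sigma) instead. Conjugating the structure
    equations gives equations of the same shape, with A, M, E, F, P replaced by
    their conjugates and with C unchanged, because C is real:
    for pi' = conj pi, A' = conj A and P' = conj P, the conjugate of
    (1/2) A pi pi is (1/2) A' pi' pi', and that of
    (1/2) P (conj A) (conj pi) (conj pi) is
    (1/2) P' (conj A') (conj pi') (conj pi'). A theta^i that is imaginary on
    real vectors has an imaginary conjugate ([vessiotCoframe_push]). In both
    cases one real array C consists of structure constants of g1 and of g2, and
    the linear map matching the two bases is an isomorphism
    ([structure_constants_isomorphic]).

    Both cases are treated at once by twisting the push-forward by [twist b],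
    which is the identity of C or the complex conjugation according to [b]. It
    is an involutive ring morphism that fixes the reals, commutes with
    conjugation and preserves analyticity, which is all that naturality uses;
    only i remembers [b], as it is multiplied by (-1)^b, and this sign is the
    one in J2 Phi_* = +- Phi_* J1 ([eigendist_push]). Every push-forward is a
    bijection inverted by the push-forward along the inverse diffeomorphism, so
    one inclusion, proved for all diffeomorphisms, gives an equality.

    The integers d and m of E1 and E2 agree since the images of bases of D1 and
    of the cotangent space are bases of the corresponding spaces on the other
    side, where bases of the expected size are available ([ell_d_eq],
    [coframe_dim_eq]). *)

(** * Sizes of bases and structure constants *)

Lemma lincomb_unit (R : realType) (T : Type) (K : finType)
    (e : K -> T -> R[i]) (k : K) :
  e k = lincomb (fun l => (l == k)%:R) e.
Proof.
apply/funext => t; rewrite /lincomb (bigD1 k)//= eqxx mul1r big1 ?addr0//.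
by move=> l /negPf->; rewrite mul0r.
Qed.

(** The two families have inverse change-of-basis matrices. The scalars act
    through [phi], which is the identity for complex spans and the inclusion of
    the reals for real spans. *)
Lemma basis_card_le (R : realType) (T : Type) (K L : finType) (F : fieldType)
    (phi : {rmorphism F -> R[i]}) (e : K -> T -> R[i]) (f : L -> T -> R[i]) :
  (forall k, exists c, e k = lincomb (fun l => phi (c l)) f) ->
  (forall l, exists c, f l = lincomb (fun k => phi (c k)) e) ->
  (forall c, lincomb (fun k => phi (c k)) e = (fun=> 0) -> forall k, c k = 0) ->
  (#|K| <= #|L|)%N.
Proof.
move=> /choice[A eA] /choice[B fB] free_e.
pose A' : 'M[F]_(#|K|, #|L|) := \matrix_(i, j) A (enum_val i) (enum_val j).
pose B' : 'M[F]_(#|L|, #|K|) := \matrix_(j, i) B (enum_val j) (enum_val i).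
suff : A' *m B' = 1%:M by apply: mulmx1_min.
have eAB k :
    lincomb (fun k' => phi (\sum_l A k l * B l k' - (k' == k)%:R)) e =
    (fun=> 0).
  apply/funext => t; rewrite /lincomb.
  under eq_bigr do rewrite rmorphB rmorph_nat mulrBl.
  rewrite sumrB; apply/eqP; rewrite subr_eq0; apply/eqP.
  transitivity (e k t); last by rewrite [e k]lincomb_unit.
  rewrite [in RHS]eA /lincomb.
  under [RHS]eq_bigr do rewrite fB /lincomb mulr_sumr.
  rewrite exchange_big; apply: eq_bigr => k' _.
  by rewrite rmorph_sum mulr_suml; apply: eq_bigr => l _; rewrite rmorphM mulrA.
apply/matrixP => i j; rewrite !mxE.
have /(_ (enum_val j))/eqP/= := free_e _ (eAB (enum_val i)).
rewrite subr_eq0 (inj_eq enum_val_inj) (eq_sym j) => /eqP <-.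
rewrite [RHS](reindex (enum_val : 'I_#|L| -> L)) /=; last first.
  exact/onW_bij/enum_val_bij.
by apply: eq_bigr => l _; rewrite !mxE.
Qed.

Lemma cbasis_card (R : realType) (T : Type) (K L : finType)
    (S : set (T -> R[i])) (e : K -> T -> R[i]) (f : L -> T -> R[i]) :
  cbasis S e -> cbasis S f -> #|K| = #|L|.
Proof.
move=> [Se free_e] [Sf free_f].
have Se_ k : cspan f (e k).
  by rewrite -Sf Se; exists (fun l => (l == k)%:R); apply: lincomb_unit.
have Sf_ l : cspan e (f l).
  by rewrite -Se Sf; exists (fun k => (k == l)%:R); apply: lincomb_unit.
apply/eqP; rewrite eqn_leq (@basis_card_le _ _ _ _ _ idfun e f)//.
exact: (@basis_card_le _ _ _ _ _ idfun f e).
Qed.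

Lemma rbasis_card (R : realType) (T : Type) (K L : finType)
    (S : set (T -> R[i])) (e : K -> T -> R[i]) (f : L -> T -> R[i]) :
  rbasis S e -> rbasis S f -> #|K| = #|L|.
Proof.
have rspan_unit (I : finType) (v : I -> T -> R[i]) i : rspan v (v i).
  exists (fun j => (j == i)%:R); rewrite [LHS]lincomb_unit.
  by congr lincomb; apply/funext => j; rewrite rmorph_nat.
move=> [Se free_e] [Sf free_f].
have Se_ k : rspan f (e k) by rewrite -Sf Se; apply: rspan_unit.
have Sf_ l : rspan e (f l) by rewrite -Se Sf; apply: rspan_unit.
apply/eqP; rewrite eqn_leq (@basis_card_le _ _ _ _ _ (real_complex R) e f)//.
exact: (@basis_card_le _ _ _ _ _ (real_complex R) f e).
Qed.

Lemma lie_sum (R : realType) (g : lieAlgebra R) (K : finType) (a b : K -> R)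
    (e : K -> g) :
  lie (\sum_i a i *: e i) (\sum_j b j *: e j) =
  \sum_i \sum_j (a i * b j) *: lie (e i) (e j).
Proof.
have lie0l (x : g) : lie 0 x = 0.
  by have := lie_linearl (-1) 0 0 x; rewrite scaler0 addr0 scaleN1r addNr.
have lie0r (x : g) : lie x 0 = 0.
  by have := lie_linearr (-1) x 0 0; rewrite scaler0 addr0 scaleN1r addNr.
have suml z : lie (\sum_i a i *: e i) z = \sum_i a i *: lie (e i) z.
  by elim/big_rec2: _ => [|i y1 y2 _ <-]; rewrite ?lie0l ?lie_linearl.
have sumr z : lie z (\sum_i b i *: e i) = \sum_i b i *: lie z (e i).
  by elim/big_rec2: _ => [|i y1 y2 _ <-]; rewrite ?lie0r ?lie_linearr.
rewrite suml; apply: eq_bigr => i _; rewrite sumr scaler_sumr.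
by apply: eq_bigr => j _; rewrite scalerA.
Qed.

Lemma linear_of_basis (R : fieldType) (V W : vectType R) n
    (u : n.-tuple V) (w : n.-tuple W) :
  basis_of fullv u ->
  exists f : {linear V -> W}, forall i, f (tnth u i) = tnth w i.
Proof.
move=> /basis_free free_u.
pose f (x : V) : W := \sum_i coord u i x *: tnth w i.
have f_lin : linear f.
  move=> a x y; rewrite /f scaler_sumr -big_split; apply: eq_bigr => i _.
  by rewrite linearP scalerDl scalerA.
exists (HB.pack_for {linear V -> W} f
  (GRing.isLinear.Build R V W *:%R f f_lin)).
move=> i; rewrite /= /f (bigD1 i)//= (tnth_nth 0).
rewrite coord_free// eqxx scale1r big1 ?addr0// => j ij.
by rewrite coord_free// eq_sym (negPf ij) scale0r.
Qed.

Lemma structure_constants_isomorphic (R : realType) (g h : lieAlgebra R) n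
    (C : 'I_n -> 'I_n -> 'I_n -> R) :
  structure_constants g C -> structure_constants h C -> lie_isomorphic g h.
Proof.
move=> [e [be eC]] [f [bf fC]].
have coordE (k : lieAlgebra R) (u : n.-tuple k) (x : k) : basis_of fullv u ->
    x = \sum_i coord u i x *: tnth u i.
  move=> bu; rewrite [LHS](coord_basis bu (memvf x)).
  by apply: eq_bigr => i _; rewrite (tnth_nth 0).
have [F Fe] := linear_of_basis f be; have [G Gf] := linear_of_basis e bf.
have FZ a i : F (a *: tnth e i) = a *: tnth f i by rewrite linearZ /= Fe.
have GZ a i : G (a *: tnth f i) = a *: tnth e i by rewrite linearZ /= Gf.
exists F; split.
  exists G => x.
    rewrite [x](coordE _ _ _ be) !linear_sum.
    by apply: eq_bigr => i _; rewrite FZ GZ.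
  rewrite [x](coordE _ _ _ bf) !linear_sum.
  by apply: eq_bigr => i _; rewrite GZ FZ.
move=> x y; rewrite [x](coordE _ _ _ be) [y](coordE _ _ _ be).
rewrite lie_sum !linear_sum.
under [X in _ = lie X _]eq_bigr do rewrite FZ.
under [X in _ = lie _ X]eq_bigr do rewrite FZ.
rewrite lie_sum; apply: eq_bigr => i _.
rewrite linear_sum; apply: eq_bigr => j _.
rewrite linearZ /= eC fC linear_sum.
by congr (_ *: _); apply: eq_bigr => k _; rewrite FZ.
Qed.

(** * Twisted push-forward of functions, vectors and covectors *)

Section Twist.
Variables (R : realType) (b : bool).
Implicit Types z : R[i].

Definition twist z := if b then conjc z else z.

Lemma twist_additive : {morph twist : z w / z - w}.
Proof. by rewrite /twist; case: b => // z w; rewrite rmorphB. Qed.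

Lemma twist_multiplicative : monoid_morphism twist.
Proof.
rewrite /twist; case: b; split=> [|z w] //; [exact: rmorph1|exact: rmorphM].
Qed.

HB.instance Definition _ :=
  GRing.isZmodMorphism.Build R[i] R[i] twist twist_additive.
HB.instance Definition _ :=
  GRing.isMonoidMorphism.Build R[i] R[i] twist twist_multiplicative.

Lemma twistK : involutive twist.
Proof. by rewrite /twist; case: b => // z; apply: conjcK. Qed.

Lemma twist_real (a : R) : twist a%:C = a%:C.
Proof. by rewrite /twist; case: b => //=; rewrite oppr0. Qed.

Lemma twist_conj z : twist (conjc z) = conjc (twist z).
Proof. by rewrite /twist; case: b. Qed.

Lemma twist_i : twist 'i%C = ((-1) ^+ b)%:C * 'i%C.
Proof.
rewrite /twist; case: b; last by rewrite expr0 mul1r.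
by rewrite expr1 rmorphN mulN1r; apply/eqP; rewrite eq_complex /= oppr0 !eqxx.
Qed.

Lemma twist_Re z : complex.Re (twist z) = complex.Re z.
Proof. by rewrite /twist; case: b => //; case: z. Qed.

Lemma twist_Im z : complex.Im (twist z) = (-1) ^+ b * complex.Im z.
Proof. by rewrite /twist; case: b; case: z => x y; rewrite ?mulN1r ?mul1r. Qed.

End Twist.

(** Conjugation changes the sign of imaginary parts, so that it preserves
    analyticity of complex functions as soon as negation preserves that of real
    ones. *)
Lemma real_analyticN (R : realType) m (f : 'rV[R]_m -> R) a :
  real_analytic f a -> real_analytic (fun x => - f x) a.
Proof.
move=> [c [r [r0 cf]]]; exists (fun alpha => - c alpha), r; split=> // h hr.
have [[B hB] cvg_f] := cf h hr; split.
  by exists B => N; under eq_bigr do rewrite mulNr normrN.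
under eq_fun do (under eq_bigr do rewrite mulNr; rewrite sumrN).
exact: cvgN.
Qed.

Lemma analytic_atN (R : realType) (M : analyticManifold R) (f : M -> R) x :
  analytic_at f x -> analytic_at (fun y => - f y) x.
Proof.
have [U [phi [psi [[_ Ux _] chartU]]]] := mf_charts x.
by have [_ _ _ aE] := chartU x Ux; rewrite !aE; apply: real_analyticN.
Qed.

Lemma canalytic_at_twist (R : realType) (M : analyticManifold R) b
    (f : M -> R[i]) x :
  canalytic_at f x -> canalytic_at (fun y => twist b (f y)) x.
Proof.
move=> [aRe aIm]; split; first by under eq_fun do rewrite twist_Re.
under eq_fun do rewrite twist_Im.
case: b; last by under eq_fun do rewrite expr0 mul1r.
by under eq_fun do rewrite expr1 mulN1r; apply: analytic_atN.
Qed.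

Record analyticIso (R : realType) (M N : analyticManifold R) := AnalyticIso {
  iso_fun :> M -> N;
  iso_inv : N -> M;
  iso_funK : cancel iso_fun iso_inv;
  iso_invK : cancel iso_inv iso_fun;
  iso_fun_analytic : analytic_map iso_fun;
  iso_inv_analytic : analytic_map iso_inv
}.

Definition iso_sym (R : realType) (M N : analyticManifold R)
    (Phi : analyticIso M N) : analyticIso N M :=
  AnalyticIso (iso_invK Phi) (iso_funK Phi)
    (iso_inv_analytic Phi) (iso_fun_analytic Phi).

Section Push.
Variables (R : realType) (b : bool).
Implicit Types M N : analyticManifold R.

Definition push_fun M N (Phi : analyticIso M N) (f : M -> R[i]) : N -> R[i] :=
  fun y => twist b (f (iso_inv Phi y)).

(** Twisting both the argument and the value makes [push_vec] semilinear for
    [twist] and keeps derivations complex-linear. On real vectors it is the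
    ordinary push-forward for both values of [b]. *)
Definition push_vec M N (Phi : analyticIso M N) (v : tvec M) : tvec N :=
  fun g => twist b (v (push_fun (iso_sym Phi) g)).

Definition push_covec M N (Phi : analyticIso M N) (w : covec M) : covec N :=
  fun v => twist b (w (push_vec (iso_sym Phi) v)).

Definition push_field M N (Phi : analyticIso M N) (X : M -> tvec M) :
    N -> tvec N :=
  fun y => push_vec Phi (X (iso_inv Phi y)).

Definition push_form M N (Phi : analyticIso M N) (w : M -> covec M) :
    N -> covec N :=
  fun y => push_covec Phi (w (iso_inv Phi y)).

Definition push_system M N (Phi : analyticIso M N) (V : M -> set (covec M)) :
    N -> set (covec N) :=
  fun y => [set w | V (iso_inv Phi y) (push_covec (iso_sym Phi) w)].

Variables (M N : analyticManifold R) (Phi : analyticIso M N).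
Local Notation Psi := (iso_sym Phi).

Lemma push_funK : cancel (push_fun Phi) (push_fun Psi).
Proof.
by move=> f; apply/funext => x; rewrite /push_fun /= iso_funK twistK.
Qed.

Lemma push_invfunK : cancel (push_fun Psi) (push_fun Phi).
Proof.
by move=> f; apply/funext => x; rewrite /push_fun /= iso_invK twistK.
Qed.

Lemma push_vecK : cancel (push_vec Phi) (push_vec Psi).
Proof.
move=> v; apply/funext => f; rewrite /push_vec twistK.
by congr v; apply: (push_funK).
Qed.

Lemma push_invvecK : cancel (push_vec Psi) (push_vec Phi).
Proof.
move=> v; apply/funext => f; rewrite /push_vec twistK.
by congr v; apply: (push_invfunK).
Qed.

Lemma push_covecK : cancel (push_covec Phi) (push_covec Psi).
Proof.
move=> v; apply/funext => f; rewrite /push_covec twistK.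
by congr v; apply: (push_vecK).
Qed.

Lemma push_invcovecK : cancel (push_covec Psi) (push_covec Phi).
Proof.
move=> v; apply/funext => f; rewrite /push_covec twistK.
by congr v; apply: (push_invvecK).
Qed.

Lemma open_iso_inv (U : set M) : open U -> open (iso_inv Phi @^-1` U).
Proof.
by move=> oU; apply: open_comp => // y _; apply: (iso_inv_analytic Phi).1.
Qed.

Lemma canalytic_at_push f y :
  canalytic_at f (iso_inv Phi y) -> canalytic_at (push_fun Phi f) y.
Proof.
move=> [aRe aIm]; apply: (@canalytic_at_twist _ _ b (f \o iso_inv Phi)).
have [_ aPsi] := iso_inv_analytic Phi.
by split; [exact: aPsi aRe|exact: aPsi aIm].
Qed.

Lemma push_fun_lin a (f g : M -> R[i]) :
  push_fun Phi (fun x => a * f x + g x) =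
  (fun y => twist b a * push_fun Phi f y + push_fun Phi g y).
Proof. by apply/funext => y; rewrite /push_fun rmorphD rmorphM. Qed.

End Push.

Section PushTangent.
Variables (R : realType) (b : bool) (M N : analyticManifold R).
Variables (Phi : analyticIso M N).
Local Notation Psi := (iso_sym Phi).
Local Notation inv := (iso_inv Phi).
Local Notation pfV := (push_fun b Psi).
Local Notation pv := (push_vec b Phi).

Lemma canalytic_at_pull g y : canalytic_at g y <-> canalytic_at (pfV g) (inv y).
Proof.
split; first by move=> ag; apply: canalytic_at_push; rewrite /= iso_invK.
by move=> /(@canalytic_at_push _ b _ _ Phi); rewrite push_invfunK.
Qed.

Lemma ctangent_push y v : ctangent (inv y) v -> ctangent y (pv v).
Proof.
move=> [vD vM v0]; split=> [a f g|f g|f]; rewrite !canalytic_at_pull => af;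
  last first.
- by rewrite /push_vec v0// rmorph0.
- move=> ag; rewrite /push_vec.
  have -> : pfV (fun y => f y * g y) = (fun x => pfV f x * pfV g x).
    by apply/funext => x; rewrite /push_fun rmorphM.
  rewrite vM// rmorphD !rmorphM /push_fun /=.
  by rewrite !twistK iso_invK.
- move=> ag; rewrite /push_vec push_fun_lin vD// rmorphD rmorphM.
  by rewrite /= twistK.
Qed.

Lemma conj_push_vec v : conj_tvec (pv v) = pv (conj_tvec v).
Proof.
apply/funext => f; rewrite /conj_tvec /push_vec twist_conj.
congr (conjc (twist b (v _))); apply/funext => x.
by rewrite /push_fun twist_conj.
Qed.

Lemma tangent_push y v : tangent (inv y) v -> tangent y (pv v).
Proof.
by move=> [/ctangent_push ? v_real]; split; rewrite ?conj_push_vec ?v_real.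
Qed.

End PushTangent.

Section PushCotangent.
Variables (R : realType) (b : bool) (M N : analyticManifold R).
Variables (Phi : analyticIso M N).
Local Notation Psi := (iso_sym Phi).
Local Notation inv := (iso_inv Phi).
Local Notation pf := (push_fun b Phi).
Local Notation pvV := (push_vec b Psi).
Local Notation pc := (push_covec b Phi).

Lemma ctangent_pull y v : ctangent y v <-> ctangent (inv y) (pvV v).
Proof.
split; first by move=> av; apply: ctangent_push; rewrite /= iso_invK.
by move=> /(@ctangent_push _ b _ _ Phi); rewrite push_invvecK.
Qed.

Lemma ccotangent_push y w : ccotangent (inv y) w -> ccotangent y (pc w).
Proof.
move=> [wD w0]; split=> [a u v|v]; rewrite !ctangent_pull => tu.
  move=> tv; rewrite /push_covec.
  have -> : pvV (fun f => a * u f + v f) =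
      (fun g => twist b a * pvV u g + pvV v g).
    by apply/funext => g; rewrite /push_vec rmorphD rmorphM.
  by rewrite wD// rmorphD rmorphM /= twistK.
by rewrite /push_covec w0// rmorph0.
Qed.

Lemma conj_push_covec w : conj_covec (pc w) = pc (conj_covec w).
Proof.
by apply/funext => v; rewrite /conj_covec /push_covec conj_push_vec twist_conj.
Qed.

Lemma cotangent_push y w : cotangent (inv y) w -> cotangent y (pc w).
Proof.
by move=> [/ccotangent_push ? w_real]; split; rewrite ?conj_push_covec ?w_real.
Qed.

Lemma differential_push f y :
  differential (pf f) y = pc (differential f (inv y)).
Proof.
apply/funext => v; rewrite /differential /push_covec.
case: asboolP => [tv|ntv]; case: asboolP => [tv'|ntv'].
- rewrite /push_vec twistK; congr v; exact/esym/(push_funK b Psi).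
- by case: ntv'; apply/ctangent_pull.
- by case: ntv; apply/ctangent_pull.
- by rewrite rmorph0.
Qed.

Lemma cfield_push U X : cfield U X -> cfield (inv @^-1` U) (push_field b Phi X).
Proof.
move=> fX y /fX[tX aX]; split; first exact: ctangent_push.
move=> f /(canalytic_at_pull b Phi) /aX aXf.
exact: (@canalytic_at_push _ b _ _ Phi _ y aXf).
Qed.

Lemma push_field_pull X y : push_field b Psi X (inv y) = pvV (X y).
Proof. by rewrite /push_field /= iso_invK. Qed.

End PushCotangent.

(** * Naturality of brackets, exterior derivatives and derived systems *)

Section PushForms.
Variables (R : realType) (b : bool) (M N : analyticManifold R).
Variables (Phi : analyticIso M N).
Local Notation Psi := (iso_sym Phi).
Local Notation inv := (iso_inv Phi).
Local Notation pf := (push_fun b Phi).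
Local Notation pvV := (push_vec b Psi).
Local Notation pc := (push_covec b Phi).

Lemma push_vec_apply (f : M -> R[i]) v : pvV v f = twist b (v (pf f)).
Proof. by []. Qed.

Lemma open_iso_pull (W : set N) : open W -> open (Phi @^-1` W).
Proof. exact: (@open_iso_inv _ _ _ Psi). Qed.

Lemma cfield_pull W X : cfield W X -> cfield (Phi @^-1` W) (push_field b Psi X).
Proof. exact: (@cfield_push _ b _ _ Psi). Qed.

Lemma push_form_apply w (X : N -> tvec N) :
  (fun y => push_form b Phi w y (X y)) =
  pf (fun x => w x (push_field b Psi X x)).
Proof.
apply/funext => y; rewrite /push_fun -[in RHS]/inv.
by rewrite push_field_pull.
Qed.

Lemma bracket_pull (X Y : N -> tvec N) y :
  bracket (push_field b Psi X) (push_field b Psi Y) (inv y) =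
  pvV (bracket X Y y).
Proof.
apply/funext => f; rewrite push_vec_apply /bracket !push_field_pull.
rewrite !push_vec_apply.
have applyE (Z : N -> tvec N) :
    pf (fun x => push_field b Psi Z x f) = (fun y' => Z y' (pf f)).
  apply/funext => y'.
  by rewrite /push_fun push_field_pull push_vec_apply twistK.
rewrite !applyE.
rewrite (_ : `[< canalytic_at f (inv y) >] = `[< canalytic_at (pf f) y >]).
  by case: ifP; rewrite ?rmorphB ?rmorph0.
apply: asbool_equiv_eq; rewrite (canalytic_at_pull b Phi) push_funK.
by [].
Qed.

Lemma ext_deriv_at_push w y Omega :
  ext_deriv_at w (inv y) Omega ->
  ext_deriv_at (push_form b Phi w) y
    (fun u v => twist b (Omega (pvV u) (pvV v))).
Proof.
move=> dw W X Y oW Wy fX fY.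
have invW : (Phi @^-1` W) (inv y) by rewrite /= iso_invK.
have := dw _ _ _ (open_iso_pull oW) invW (cfield_pull fX) (cfield_pull fY).
rewrite !push_field_pull bracket_pull => /(congr1 (twist b)) <-.
by rewrite !rmorphB /= !push_vec_apply !twistK !push_form_apply.
Qed.

Lemma cform_push U w : cform U w -> cform (inv @^-1` U) (push_form b Phi w).
Proof.
move=> fw y /fw[tw aw]; split; first exact: ccotangent_push.
move=> W X oW Wy fX; rewrite push_form_apply; apply: canalytic_at_push.
by apply: aw (open_iso_pull oW) _ (cfield_pull fX); rewrite /= iso_invK.
Qed.

Lemma wedge_push w1 w2 u v :
  wedge (pc w1) (pc w2) u v = twist b (wedge w1 w2 (pvV u) (pvV v)).
Proof. by rewrite /wedge rmorphB !rmorphM. Qed.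

Lemma lincomb_push (K : finType) (c : K -> R[i]) (e : K -> covec M) :
  pc (lincomb c e) = lincomb (fun k => twist b (c k)) (fun k => pc (e k)).
Proof.
apply/funext => v; rewrite /push_covec /lincomb rmorph_sum.
by apply: eq_bigr => k _; rewrite rmorphM.
Qed.

Lemma cspan_push (K : finType) (e : K -> covec M) w :
  cspan e w -> cspan (fun k => pc (e k)) (pc w).
Proof.
by move=> [c ->]; exists (fun k => twist b (c k)); rewrite lincomb_push.
Qed.

Lemma deriv_in_ideal_push V w y :
  deriv_in_ideal V w (inv y) ->
  deriv_in_ideal (push_system b Phi V) (push_form b Phi w) y.
Proof.
move=> [n [a [c [Va tc dw]]]].
exists n, (fun k => pc (a k)), (fun k => pc (c k)); split=> [k|k|].
- by rewrite /push_system /= push_covecK.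
- exact: ccotangent_push.
- have := ext_deriv_at_push dw; congr ext_deriv_at.
  apply/funext => u; apply/funext => v; rewrite rmorph_sum.
  by apply: eq_bigr => k _; rewrite wedge_push.
Qed.

(** The reverse inclusion is this one for the inverse of [Phi]. *)
Lemma derived_system_push_sub V y :
  push_system b Phi (derived_system V) y `<=`
  derived_system (push_system b Phi V) y.
Proof.
move=> w [n [e [eV]]] /cspan_push; rewrite push_invcovecK => w_e.
exists n, (fun k => pc (e k)); split=> // k.
have [U [w0 [oU Uy fw0 Vw0 ->]]] := eV k.
exists (inv @^-1` U), (push_form b Phi w0); split=> //.
- exact: open_iso_inv.
- exact: cform_push.
- move=> y' /Vw0[Vw dw]; split; last exact: deriv_in_ideal_push.
  by rewrite /push_system /push_form /= push_covecK.
Qed.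

End PushForms.

Section PushSystems.
Variables (R : realType) (b : bool) (M N : analyticManifold R).
Variables (Phi : analyticIso M N).
Local Notation Psi := (iso_sym Phi).
Local Notation inv := (iso_inv Phi).
Local Notation pc := (push_covec b Phi).
Local Notation pcV := (push_covec b Psi).

Lemma push_systemK : cancel (push_system b Phi) (push_system b Psi).
Proof.
move=> V; apply/funext => x; apply/funext => w; rewrite /push_system /=.
by rewrite iso_funK (push_covecK b Phi).
Qed.

Lemma derived_system_push V :
  derived_system (push_system b Phi V) = push_system b Phi (derived_system V).
Proof.
apply/funext => y; apply/seteqP; split; last exact: derived_system_push_sub.
move=> w dw; rewrite /push_system /=.
rewrite -{1}(push_systemK V); apply: derived_system_push_sub.
by rewrite /push_system /= iso_invK push_invcovecK.
Qed.

Lemma terminal_system_push V :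
  terminal_system (push_system b Phi V) = push_system b Phi (terminal_system V).
Proof.
have iterE k : iter k (@derived_system R N) (push_system b Phi V) =
    push_system b Phi (iter k (@derived_system R M) V).
  by elim: k => //= k ->; rewrite derived_system_push.
apply/funext => y; apply/seteqP; split=> w Vw k; have := Vw k.
  by rewrite iterE.
by rewrite iterE.
Qed.

Lemma cspan_push_system (K : finType) (e : K -> covec M) V y :
  V (inv y) = cspan e -> push_system b Phi V y = cspan (fun k => pc (e k)).
Proof.
move=> Ve; apply/seteqP; split=> w; rewrite /push_system /= Ve.
  by move/(cspan_push b Phi); rewrite push_invcovecK.
move/(cspan_push b Psi); congr cspan; apply/funext => k.
exact: push_covecK.
Qed.

Lemma cbasis_push_system (K : finType) (e : K -> covec M) V y :
  cbasis (V (inv y)) e -> cbasis (push_system b Phi V y) (fun k => pc (e k)).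
Proof.
move=> [/cspan_push_system Ve free_e]; split=> // c /(congr1 pcV) ce k.
apply: (can_inj (twistK b)); rewrite rmorph0.
have {}free_e := free_e (fun k => twist b (c k)); apply: free_e.
rewrite (_ : (fun=> 0) = pcV (fun=> 0)); last first.
  by apply/funext => v; rewrite /push_covec rmorph0.
rewrite -ce lincomb_push; congr lincomb; apply/funext => l.
by rewrite push_covecK.
Qed.

Lemma ccotangent_push_system :
  push_system b Phi (@ccotangent R M) = @ccotangent R N.
Proof.
apply/funext => y; apply/seteqP; split=> w; rewrite /push_system /=.
  by move/(@ccotangent_push _ b _ _ Phi); rewrite push_invcovecK.
by move=> tw; apply: ccotangent_push; rewrite /= iso_invK.
Qed.

End PushSystems.

(** * Elliptic distributions and their bundles *)

(** The sign is the factor by which [twist b] multiplies i. *)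
Definition intertwines (R : realType) b (M N : analyticManifold R)
    (Phi : analyticIso M N) (E : ellipticDistribution M)
    (E' : ellipticDistribution N) : Prop :=
  [/\ forall x v, ell_D E x v -> ell_D E' (Phi x) (push_vec b Phi v),
      forall y v, ell_D E' y v ->
        ell_D E (iso_inv Phi y) (push_vec b (iso_sym Phi) v)
    & forall x v, ell_D E x v -> ell_J E' (Phi x) (push_vec b Phi v) =
        (fun g => ((-1) ^+ b)%:C * push_vec b Phi (ell_J E x v) g)].

Section EllipticLinearity.
Variables (R : realType) (M : analyticManifold R) (E : ellipticDistribution M).

Lemma ell_D_scale x (a : R) v : ell_D E x v -> ell_D E x (fun f => a%:C * v f).
Proof.
have [U [X [_ Ux _ /(_ x Ux)[-> _]]]] := (ell_subbundle E).2 x.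
move=> [c ->]; exists (fun k => a * c k); apply/funext => f.
by rewrite /lincomb mulr_sumr; apply: eq_bigr => k _; rewrite rmorphM mulrA.
Qed.

Lemma ell_J_scale x (a : R) v : ell_D E x v ->
  ell_J E x (fun f => a%:C * v f) = (fun f => a%:C * ell_J E x v f).
Proof.
move=> Dv; pose z : tvec M := fun=> 0.
have Dz : ell_D E x z.
  have := ell_D_scale 0 Dv; congr (ell_D E x); apply/funext => f.
  by rewrite mul0r.
have Jz : ell_J E x z = z.
  have := ell_J_linear 1 Dz Dz.
  under eq_fun do rewrite mulr0 addr0.
  move=> Jzz; apply/funext => f; have := congr1 (fun u : tvec M => u f) Jzz.
  rewrite /= mul1r -[LHS]addr0 => /addrI <-.
  by [].
have := ell_J_linear a Dv Dz; rewrite Jz.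
by under eq_fun do rewrite addr0; under [in RHS]eq_fun do rewrite addr0.
Qed.

Lemma ell_D_tangent x : ell_D E x `<=` tangent x.
Proof. exact: (ell_subbundle E).1. Qed.

End EllipticLinearity.

Section PushElliptic.
Variables (R : realType) (b : bool) (M N : analyticManifold R).
Variables (Phi : analyticIso M N).
Variables (E : ellipticDistribution M) (E' : ellipticDistribution N).
Hypothesis EE' : intertwines b Phi E E'.
Local Notation Psi := (iso_sym Phi).
Local Notation pv := (push_vec b Phi).

Lemma intertwines_sym : intertwines b Psi E' E.
Proof.
have [DD' D'D JJ'] := EE'; split=> // y v Dv.
have := JJ' _ _ (D'D _ _ Dv); rewrite iso_invK push_invvecK => ->.
apply/funext => f; rewrite [in RHS]/push_vec rmorphM /= twist_real mulrA.
rewrite -rmorphM -expr2 sqrr_sign mul1r.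
by rewrite -[in LHS](push_vecK b Phi (ell_J E _ _)).
Qed.

(** For z = v + i w in D (x) C, the twisted push-forward of z is
    v' + i ((-1)^b w'), with v' and w' those of v and w. Two signs (-1)^b occur,
    one in J2 v' and one in the twist of the eigenvalue -i, and they cancel: the
    eigenvalue stays -i, although a J-reversing [Phi] maps D_- to D_+ when
    complex scalars are not conjugated. *)
Lemma eigendist_push x z :
  eigendist (ell_D E) (ell_J E) (- 'i%C) x z ->
  eigendist (ell_D E') (ell_J E') (- 'i%C) (Phi x) (pv z).
Proof.
have [DD' _ JJ'] := EE'; move=> [v [w [Dv Dw -> Jz]]].
have ee : ((-1) ^+ b)%:C * ((-1) ^+ b)%:C = 1 :> R[i].
  by rewrite -rmorphM -expr2 sqrr_sign.
exists (pv v), (fun g => ((-1) ^+ b)%:C * pv w g); split.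
- exact: DD'.
- exact/ell_D_scale/DD'.
- apply/funext => g; rewrite /add_i /push_vec rmorphD rmorphM /= twist_i.
  by rewrite mulrCA mulrA.
rewrite ell_J_scale; last exact: DD'.
rewrite !JJ'//; apply/funext => g.
have := congr1 (fun u : tvec M => twist b (u (push_fun b Psi g))) Jz.
rewrite /add_i rmorphD !rmorphM rmorphN /= twist_i => JE.
rewrite [in LHS]/push_vec /add_i [in RHS]/push_vec.
set e := ((-1) ^+ b)%:C in ee JE *.
rewrite (mulrA e e) ee mul1r -[X in _ + X]mul1r -[in X in _ + X]ee.
rewrite -!mulrA -mulrDr (mulrA e 'i%C) JE mulrA.
by rewrite mulrN mulrA ee mul1r.
Qed.

End PushElliptic.

Section PushBundles.
Variables (R : realType) (b : bool) (M N : analyticManifold R).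
Variables (Phi : analyticIso M N).
Variables (E : ellipticDistribution M) (E' : ellipticDistribution N).
Hypothesis EE' : intertwines b Phi E E'.
Local Notation Psi := (iso_sym Phi).
Local Notation inv := (iso_inv Phi).
Local Notation pv := (push_vec b Phi).
Local Notation pvV := (push_vec b Psi).
Local Notation pc := (push_covec b Phi).

Lemma annihilator_push_system (S : M -> set (tvec M)) (S' : N -> set (tvec N)) :
  (forall x v, S x v -> S' (Phi x) (pv v)) ->
  (forall y v, S' y v -> S (inv y) (pvV v)) ->
  push_system b Phi (annihilator S) = annihilator S'.
Proof.
move=> SS' S'S; apply/funext => y.
apply/seteqP; split=> w; rewrite /push_system /=.
  move=> [tw w0]; split.
    by rewrite -(ccotangent_push_system b Phi).
  move=> v /S'S /w0 wv0; apply: (can_inj (twistK b)); rewrite rmorph0 -[RHS]wv0.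
  by congr (twist b (w _)); exact/esym/(push_invvecK b Phi).
move=> [tw w0]; split; first by apply: ccotangent_push; rewrite /= iso_invK.
move=> v /SS'; rewrite iso_invK => /w0 wv0.
by rewrite /push_covec; apply: (canLR (twistK b)); rewrite wv0 rmorph0.
Qed.

Lemma ell_V_push : push_system b Phi (ell_V E) = ell_V E'.
Proof.
apply: annihilator_push_system => [x v|y v]; first exact: eigendist_push.
exact: (eigendist_push (intertwines_sym EE')).
Qed.

Lemma ell_Vinf_push : push_system b Phi (ell_Vinf E) = ell_Vinf E'.
Proof. by rewrite /ell_Vinf -ell_V_push terminal_system_push. Qed.

Lemma ell_I_push y w : ell_I E (inv y) w -> ell_I E' y (pc w).
Proof.
move=> [/cotangent_push tw Iw]; split=> //.
have [DD' D'D _] := EE'; rewrite -(annihilator_push_system DD' D'D).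
by rewrite /push_system /= push_covecK.
Qed.

Lemma ell_IN x w : ell_I E x w -> ell_I E x (fun v => - w v).
Proof.
move=> [[[wD w0] w_real] [_ Iw]].
have tw : ccotangent x (fun v => - w v).
  by split=> [a u v tu tv|v /w0 ->]; rewrite ?oppr0// wD// opprD mulrN.
do 2!split=> //; last by move=> v /Iw ->; rewrite oppr0.
by apply/funext => v; rewrite -[in RHS]w_real /conj_covec rmorphN.
Qed.

Lemma complexify_ell_I_push_sub y w :
  complexify (ell_I E (inv y)) w -> complexify (ell_I E' y) (pc w).
Proof.
move=> [u [v [Iu Iv ->]]].
(* The sign by which i is multiplied is moved into the imaginary part, which
   may change sign because [ell_I] is a real vector space. *)
exists (pc u), (pc (fun t => ((-1) ^+ b)%:C * v t)); split.
- exact: ell_I_push.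
- apply: ell_I_push; case: (b); last by under eq_fun do rewrite expr0 mul1r.
  by under eq_fun do rewrite expr1 rmorphN mulN1r; apply: ell_IN.
- apply/funext => t; rewrite /add_i /push_covec rmorphD !rmorphM /= twist_i.
  by rewrite twist_real mulrCA mulrA.
Qed.

End PushBundles.

(** * Push-forward of a Vessiot coframe *)

Section PushCoframe.
Variables (R : realType) (b : bool) (M N : analyticManifold R).
Variables (Phi : analyticIso M N).
Variables (E : ellipticDistribution M) (E' : ellipticDistribution N).
Hypothesis EE' : intertwines b Phi E E'.
Local Notation Psi := (iso_sym Phi).
Local Notation inv := (iso_inv Phi).
Local Notation pv := (push_vec b Phi).
Local Notation pvV := (push_vec b Psi).
Local Notation pc := (push_covec b Phi).
Local Notation pf := (push_fun b Phi).

Lemma complexify_ell_I_push :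
  push_system b Phi (fun x => complexify (ell_I E x)) =
  (fun y => complexify (ell_I E' y)).
Proof.
apply/funext => y; apply/seteqP; split=> w; rewrite /push_system /=.
  by move/(complexify_ell_I_push_sub EE'); rewrite push_invcovecK.
move=> Iw; apply: (complexify_ell_I_push_sub (intertwines_sym EE')).
by rewrite /= iso_invK.
Qed.

(** The push-forward of a real basis of D1 is a basis of D2, so that the ranks
    2d agree. *)
Lemma ell_d_eq (x : M) : ell_d E = ell_d E'.
Proof.
have [U [X [_ Ux _ /(_ x Ux) DX]]] := (ell_subbundle E).2 x.
have [U' [X' [_ Ux' _ /(_ _ Ux') DX']]] := (ell_subbundle E').2 (Phi x).
have [DD' D'D _] := EE'.
suff pX : rbasis (ell_D E' (Phi x)) (fun k => pv (X k x)).
  have := rbasis_card pX DX'; rewrite !card_ord.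
  by move/eqP; rewrite eqn_pmul2l// => /eqP.
have push_lincomb (P Q : analyticManifold R) (Th : analyticIso P Q)
    (K : finType) (a : K -> R) (e : K -> tvec P) :
    push_vec b Th (lincomb (fun k => (a k)%:C) e) =
    lincomb (fun k => (a k)%:C) (fun k => push_vec b Th (e k)).
  apply/funext => g; rewrite /push_vec /lincomb rmorph_sum.
  apply: eq_bigr => k _.
  by rewrite rmorphM /= twist_real.
split.
  apply/seteqP; split=> [v /D'D|v [a ->]].
    rewrite iso_funK DX.1 => -[a] /(congr1 pv); rewrite push_invvecK => ->.
    by exists a; rewrite push_lincomb.
  by rewrite -push_lincomb; apply: DD'; rewrite DX.1; exists a.
move=> a a0; apply: DX.2; apply: (can_inj (push_vecK b Phi)).
rewrite push_lincomb a0; apply/funext => g.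
by rewrite /push_vec rmorph0.
Qed.

Lemma darboux_invariant_push U f :
  darboux_invariant E U f -> darboux_invariant E' (inv @^-1` U) (pf f).
Proof.
move=> If y /If[af Vf]; split; first exact: canalytic_at_push.
by rewrite differential_push -(ell_Vinf_push EE') /push_system /= push_covecK.
Qed.

Lemma with_conj_push (K : finType) (e : K -> covec M) a :
  with_conj (fun k => pc (e k)) a = pc (with_conj e a).
Proof. by case: a => k //=; rewrite conj_push_covec. Qed.

Lemma join_forms_push (K L : finType) (e : K -> covec M) (f : L -> covec M) a :
  join_forms (fun k => pc (e k)) (fun l => pc (f l)) a = pc (join_forms e f a).
Proof. by case: a. Qed.

Lemma pi_forms_push s d (eta : 'I_s -> M -> covec M)
    (sigma : 'I_d -> M -> covec M) y :
  pi_forms (fun r => push_form b Phi (eta r))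
    (fun u => push_form b Phi (sigma u)) y =
  (fun a => pc (pi_forms eta sigma (inv y) a)).
Proof. by apply/funext; case. Qed.

Lemma twist_wedge_sum (K L : finType) (c : K -> L -> R[i]) (e : K -> covec M)
    (f : L -> covec M) u v :
  twist b (\sum_k \sum_l c k l * wedge (e k) (f l) (pvV u) (pvV v)) =
  \sum_k \sum_l twist b (c k l) * wedge (pc (e k)) (pc (f l)) u v.
Proof.
rewrite rmorph_sum; apply: eq_bigr => k _; rewrite rmorph_sum.
by apply: eq_bigr => l _; rewrite rmorphM wedge_push.
Qed.

End PushCoframe.

(** The new coefficients are the twisted ones. In the equation for d theta^i,
    twisting commutes with the conjugations that are already there and fixes
    2^-1 and the real constants C, so each term goes to the same term of the
    new coframe. *)
Lemma vessiotCoframe_push (R : realType) b (M N : analyticManifold R)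
    (Phi : analyticIso M N) (E : ellipticDistribution M)
    (E' : ellipticDistribution N) x0 n (C : 'I_n -> 'I_n -> 'I_n -> R) :
  intertwines b Phi E E' -> mf_dim M = mf_dim N ->
  vessiotCoframe E x0 C -> vessiotCoframe E' (Phi x0) C.
Proof.
move=> EE' dimMN F; have d_eq := ell_d_eq EE' x0.
have VE' := ell_Vinf_push EE'.
have IE' := complexify_ell_I_push EE'.
have inv_push := darboux_invariant_push EE'.
(* The equality of the integers d is turned into a conversion, so that the same
   index type serves for the sigma^u on both sides. *)
case: E' d_eq EE' VE' IE' inv_push =>
  d' D' J' lt' sub' term' st' lin' an' sq' br' crD crV /= d_eq.
move: sub' lt' crD crV; rewrite -{}d_eq.
move=> sub' lt' crD crV EE' VE' IE' inv_push.
set E' := EllipticDistribution _ _ _ _ _ _ _ _ _ _ in EE' VE' IE' inv_push *.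
pose pfm w := push_form b Phi w.
pose tw f := push_fun b Phi f.
unshelve eapply (@VessiotCoframe R N E' (Phi x0) n C (vc_s F)
  (iso_inv Phi @^-1` vc_dom F) (fun i => pfm (vc_theta F i))
  (fun r : 'I_(vc_s F) => pfm (vc_eta r)) (fun u => pfm (vc_sigma F u))
  (fun i (k l : 'I_(vc_s F) + 'I_(ell_d E)) => tw (vc_A i k l))
  (fun i (k : 'I_(vc_s F) + 'I_(ell_d E)) j => tw (vc_M i k j))
  (fun (r : 'I_(vc_s F)) u v => tw (vc_E r u v))
  (fun (r : 'I_(vc_s F)) u t => tw (vc_F r u t))
  (fun i j => tw (vc_P F i j))).
- move=> y; have [e eE] := vc_rank_Vinf F (iso_inv Phi y).
  exists (fun k => push_covec b Phi (e k)); rewrite -VE'.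
  exact: cbasis_push_system.
- by rewrite -dimMN (vc_dim F).
- exact/open_iso_inv/vc_open.
- by rewrite /= iso_funK; apply: vc_base.
- by move=> i; apply/cform_push/vc_form_theta.
- by move=> r; apply/cform_push/vc_form_eta.
- by move=> u; apply/cform_push/vc_form_sigma.
- move=> y Uy; rewrite -(ccotangent_push_system b Phi).
  have := cbasis_push_system b (vc_coframe Uy); congr cbasis.
  apply/funext => a; rewrite -join_forms_push pi_forms_push; congr join_forms.
  by apply/funext => {}a; rewrite -with_conj_push.
- move=> y Uy; rewrite -VE' pi_forms_push.
  exact/cspan_push_system/vc_span_Vinf.
- move=> y Uy.
  rewrite -[complexify _]/((fun y => complexify (ell_I E' y)) y) -IE'.
  rewrite (cspan_push_system b (vc_span_I Uy)); congr cspan.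
  apply/funext => a; rewrite -join_forms_push; congr join_forms.
  by apply/funext => {}a; rewrite -with_conj_push.
- move=> y i Uy; have := cspan_push b Phi (vc_P_def i Uy).
  rewrite (_ : (fun k => _) = with_conj (fun r => pfm (vc_eta r) y)).
    2: by apply/funext => a; rewrite -with_conj_push.
  congr cspan; apply/funext => v.
  rewrite /push_covec rmorphB rmorph_sum /=; congr (_ - _).
  apply: eq_bigr => j _; rewrite rmorphM /=; congr (_ * _).
  by rewrite /pfm /push_form conj_push_covec.
- move=> y u Uy; have := ext_deriv_at_push b (@vc_dsigma _ _ _ _ _ _ F _ u Uy).
  by congr ext_deriv_at; apply/funext => X; apply/funext => Y; rewrite rmorph0.
- move=> y r Uy; have := ext_deriv_at_push b (@vc_deta _ _ _ _ _ _ F _ r Uy).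
  congr ext_deriv_at; apply/funext => X; apply/funext => Y.
  by rewrite rmorphD rmorphM fmorphV rmorph_nat /= !twist_wedge_sum.
- move=> y i Uy; have := ext_deriv_at_push b (@vc_dtheta _ _ _ _ _ _ F _ i Uy).
  congr ext_deriv_at; apply/funext => X; apply/funext => Y.
  rewrite !pi_forms_push !rmorphD !rmorphM fmorphV rmorph_nat /=.
  rewrite !twist_wedge_sum.
  congr (_ + _ + _ + _); congr (_ * _).
    rewrite rmorph_sum; apply: eq_bigr => j _; rewrite /= twist_wedge_sum.
    apply: eq_bigr => k _; apply: eq_bigr => l _.
    by rewrite rmorphM /= twist_conj !conj_push_covec.
  by apply: eq_bigr => j _; apply: eq_bigr => k _; rewrite twist_real.
- by move=> i k l; apply/inv_push/vc_A_inv.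
- by move=> i k j; apply/inv_push/vc_M_inv.
- by move=> r u v; apply/inv_push/vc_E_inv.
- by move=> r u t; apply/inv_push/vc_F_inv.
- move=> i v tv; rewrite /pfm /push_form /push_covec twist_Re iso_funK.
  apply: (vc_theta_imaginary F).
  by apply: (@tangent_push _ b _ _ (iso_sym Phi)).
- exact: vc_C_lie F.
Qed.

(** * Invariance of the Vessiot algebra *)

Lemma intertwines_of_equivalent (R : realType) (M N : analyticManifold R)
    (E : ellipticDistribution M) (E' : ellipticDistribution N) (Phi : M -> N) :
  equivalent_via E E' Phi ->
  exists b (Th : analyticIso M N), intertwines b Th E E'.
Proof.
move=> [[Psi [PhiK PsiK aPhi aPsi]] DD' JJ'].
pose Th := AnalyticIso PhiK PsiK aPhi aPsi.
(* If [b = true], the two conjugations in [push_vec] cancel on real vectors. *)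
have pushE b x v : ell_D E x v -> push_vec b Th v = Defs.pushforward Phi v.
  move=> /ell_D_tangent[_ v_real]; apply/funext => g.
  rewrite -[in RHS]v_real /push_vec /Defs.pushforward.
  rewrite /conj_tvec /push_fun /twist.
  by case: b => //; rewrite -[in LHS]v_real.
have D'D b y v : ell_D E' y v -> ell_D E (Psi y) (push_vec b (iso_sym Th) v).
  rewrite -{1}[y]PsiK -DD' => -[u Du <-]; rewrite -(pushE b (Psi y))//.
  by rewrite (push_vecK b Th).
have D'_push b x v : ell_D E x v -> ell_D E' (Phi x) (push_vec b Th v).
  by move=> Dv; rewrite (pushE _ x)// -DD'; exists v.
case: JJ' => [JJ'|JJ'].
  exists false, Th; split=> [x v|y v|x v Dv]; [exact: D'_push|exact: D'D|].
  rewrite !(pushE _ x)//; last exact: ell_J_stable.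
  by rewrite -JJ'//; apply/funext => g; rewrite expr0 mul1r.
exists true, Th; split=> [x v|y v|x v Dv]; [exact: D'_push|exact: D'D|].
rewrite !(pushE _ x)//; last exact: ell_J_stable.
by rewrite JJ'//; apply/funext => g; rewrite expr1 rmorphN mulN1r opprK.
Qed.

(** Both dimensions are the number of elements of a basis of the cotangent space
    at Phi(x): the push-forward of the coframe of E, and the coframe of E'. *)
Lemma coframe_dim_eq (R : realType) (M N : analyticManifold R)
    (Phi : analyticIso M N) (E : ellipticDistribution M)
    (E' : ellipticDistribution N) x n n' (C : 'I_n -> 'I_n -> 'I_n -> R)
    (C' : 'I_n' -> 'I_n' -> 'I_n' -> R) :
  vessiotCoframe E x C -> vessiotCoframe E' (Phi x) C' -> mf_dim M = mf_dim N.
Proof.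
move=> F F'; rewrite (vc_dim F) (vc_dim F').
have Ux : vc_dom F (iso_inv Phi (Phi x)) by rewrite iso_funK; apply: vc_base.
have := cbasis_push_system false (vc_coframe Ux).
rewrite ccotangent_push_system => /cbasis_card/(_ (vc_coframe (vc_base F'))).
by rewrite !card_sum !card_ord !mul2n -!addnn.
Qed.

Theorem theorem4p17 (R : realType) (M1 M2 : analyticManifold R)
    (E1 : ellipticDistribution M1) (E2 : ellipticDistribution M2)
    (g1 g2 : lieAlgebra R) (Phi : M1 -> M2) :
  connected_manifold M1 -> connected_manifold M2 ->
  darboux_integrable E1 -> darboux_integrable E2 ->
  is_vessiot_algebra E1 g1 -> is_vessiot_algebra E2 g2 ->
  equivalent_via E1 E2 Phi ->
  lie_isomorphic g1 g2.
Proof.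
move=> [[x0 _] _] _ _ _ V1 V2 /intertwines_of_equivalent[b [Th EE']].
have [[n [C [F]]] g1C] := V1 x0.
have [[n' [C' [F']]] g2C] := V2 (Th x0).
have dimM := coframe_dim_eq F F'.
apply: (structure_constants_isomorphic (g1C _ _ F)).
exact: g2C _ _ (vessiotCoframe_push EE' dimM F).
Qed.
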